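(* Let $\nu\in\mathbb{R}$, $t>0$ and $n\in\mathbb{N}$. The coefficients of the orthogonal polynomial $P_n^\nu(x,t) = \sum_{k=0}^n a_{n,k}(t) x^k$, with $a_{n,n}(t) \equiv a_n(t)$, $a_{n,n-1}(t)= b_n(t)$, fulfil the differential-recurrence relations $$ a_{n,k}(t)= a_{n,0}(t) \sum_{m=k}^{n} \frac{ a_{m} (t) \left[ a_{m}(t) a'_{m,k-1}(t) - a_{m,k-1}(t) a_{m}'(t) \right] }{ \left[ a_{m}(t) b_{m}'(t) - b_{m}(t) a_{m}'(t) \right] a_{m,0}(t)},\quad k=1,\dots, n.$$
   Context: $\mathbb{N}=\{1,2,\dots\}$, $\mathbb{N}_0=\{0,1,2,\dots\}$. For $\nu\in\mathbb{R}$, $t>0$, $\{P_n^\nu(x,t)\}_{n\ge 0}$ is the sequence of polynomials in $x$ with $P_n^\nu$ of degree exactly $n$ and $\int_0^\infty P_n^\nu(x,t)P_m^\nu(x,t)e^{-x-t/x}x^\nu dx=\delta_{n,m}$ for $n,m\in\mathbb{N}_0$; the sign is fixed so that the leading coefficient $a_n(t)$ has sign $(-1)^n$. The coefficients $a_{n,k}(t)$ are regarded as continuously differentiable functions of $t>0$; primes denote $d/dt$. *)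

(* Defs.v *)
From HB Require Import structures.
From mathcomp Require Export all_boot all_order all_algebra.
From mathcomp Require Export all_classical all_reals all_analysis.

Set Implicit Arguments.
Unset Strict Implicit.
Unset Printing Implicit Defensive.

Export Order.TTheory GRing.Theory Num.Theory.
Export numFieldNormedType.Exports.

Local Open Scope classical_set_scope.
Local Open Scope ring_scope.

Section Definitions.
Variable R : realType.
Implicit Types (nu t x : R) (P : nat -> R -> {poly R}) (n m k : nat).

(** Only used for [0 < x], where [x `^ nu] is [expR (nu * ln x)]. *)
Definition weight nu t x : R := expR (- x - t / x) * x `^ nu.

(** [coef P n k] is the function [t |-> a_{n,k}(t)]. *)
Definition coef P n k : R -> R := fun t => (P n t)`_k.

(** [a_n = a_{n,n}] and [b_n = a_{n,n-1}]; the latter is only meaningful for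
    [0 < n]. *)
Definition lcoef P n : R -> R := coef P n n.
Definition sublcoef P n : R -> R := coef P n n.-1.

(** [P n t] stands for the polynomial [P_n^nu(., t)]; its values for [t <= 0]
    are irrelevant.  The integral is extended-real valued, so that its being
    equal to [0] or [1] includes its convergence. *)
Definition orthonormal_polys nu P : Prop :=
  forall t, 0 < t ->
    [/\ forall n, size (P n t) = n.+1,
        forall n, Num.sg (lcoef P n t) = (-1) ^+ n
      & forall n m,
          (\int[lebesgue_measure]_(x in `]0%R, +oo[)
             ((P n t).[x] * (P m t).[x] * weight nu t x)%:E
           = (n == m)%:R%:E)%E].

Definition C1_pos (f : R -> R) : Prop :=
  forall t, 0 < t -> derivable f t 1 /\ {for t, continuous (derive1 f)}.

End Definitions.

(* Main.v *)
From HB Require Import structures.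
Require Import Defs.
From mathcomp Require Import measurable_realfun ring.
Set Implicit Arguments.
Unset Strict Implicit.
Unset Printing Implicit Defensive.
Local Open Scope classical_set_scope.
Local Open Scope ring_scope.

(** Write [L_t p] for the integral of [p] against the weight [w_t], and [J_t p]
    for the integral of [p] against [w_t / x], so that [L_t p = J_t ('X * p)].
    The weight satisfies [dw_t/dt = - w_t / x], hence
    [d/dt L_t p = - J_t p].

    Let [W] be the polynomial in [x] whose coefficients are
    [a_m a_{m,k}' - a_{m,k} a_m'], that is [a_m^2] times the [t]-derivative of
    the monic polynomial [P_m / a_m].  It has degree less than [m], and its
    coefficient of degree [m - 1] is [a_m b_m' - b_m a_m'].  Differentiating
    the orthogonality relation [L_t (P_m q) = 0], for [q] of degree less than
    [m], gives [L_t (W q) = a_m J_t (P_m q)] ([wronskian_dual]).  If [q] is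
    divisible by ['X] the right-hand side is again an orthogonality relation
    and vanishes.  So ['X * W] has degree at most [m] and is [L_t]-orthogonal
    to all degrees below [m - 1]: it is a combination of [P_m] and [P_{m-1}]
    ([deformation_two_term]).  The coefficient of [P_m] is read off at the top
    degree and that of [P_{m-1}] at [x = 0], where ['X * W] vanishes; the
    result is [deformation_coefE],
<<
      a_m W_{k-1} / (W_{m-1} a_{m,0}) = a_{m,k} / a_{m,0} - a_{m-1,k} / a_{m-1,0},
>>
    whose sum over [m] from [k] to [n] telescopes to the claim because
    [a_{k-1,k} = 0].

    The denominators do not vanish because [J_t] is definite on polynomials
    that are nonnegative on the half line.  If [P_m = 'X * g], then
    [J_t (P_m^2) = L_t (P_m g) = 0] ([ortho_coef0_neq0]).  If [W_{m-1} = 0],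
    then ['X * W] is a legitimate [q], so that [J_t (('X * W)^2) = 0] and
    [W = 0]; then [J_t (P_m q) = 0] for all [q] of degree less than [m], which
    together with orthogonality forces [J_t (P_m^2) = 0]
    ([deformation_lead_neq0]).

    The integrability of every polynomial against [w_t] comes from the
    orthonormality relations themselves, as they assert that the integrals of
    the [P_n P_0 w_t] are finite. *)

(** * Polynomial sequences with one polynomial in each degree *)

Lemma poly_splitX (R : nzRingType) (p : {poly R}) : exists2 g : {poly R},
  p = (p`_0)%:P + 'X * g & (size g = (size p).-1)%N.
Proof.
exists (drop_poly 1 p); last by rewrite size_drop_poly subn1.
apply/polyP => -[|i]; rewrite coefD coefC coefXM /= ?addr0// add0r.
by rewrite coef_drop_poly addn1.
Qed.

Section GradedBasis.
Variables (R : fieldType) (P : nat -> {poly R}).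
Hypothesis sizeP : forall n, size (P n) = n.+1.

Lemma graded_lead_neq0 n : (P n)`_n != 0.
Proof.
rewrite -[n in _`_n]/(n.+1.-1) -sizeP -lead_coefE lead_coef_eq0.
by rewrite -size_poly_gt0 sizeP.
Qed.

Lemma size_graded_reduce n (q : {poly R}) : (size q <= n.+1)%N ->
  (size (q - (q`_n / (P n)`_n) *: P n)%R <= n)%N.
Proof.
move=> sq; apply/leq_sizeP => j; rewrite leq_eqVlt => /orP[/eqP<-|nj].
  by rewrite coefB coefZ divfK ?graded_lead_neq0// subrr.
rewrite coefB coefZ (nth_default _ (leq_trans sq nj)).
by rewrite [(P n)`_j]nth_default ?sizeP// mulr0 subrr.
Qed.

(** The [P n] with [n < m] span the polynomials of size at most [m]; this is
    that fact as an induction principle, which replaces the choice of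
    coordinates. *)
Lemma graded_ind (K : {poly R} -> Prop) m : K 0 ->
  (forall n c q, (n < m)%N -> K q -> K (c *: P n + q)) ->
  forall q : {poly R}, (size q <= m)%N -> K q.
Proof.
move=> K0 KS q; suff H : forall n, (n <= m)%N -> forall q : {poly R}, (size q <= n)%N -> K q.
  by apply: (H m).
elim=> [_ {}q|n IH nm {}q sq]; first by rewrite leqn0 size_poly_eq0 => /eqP->.
rewrite -(subrKC ((q`_n / (P n)`_n) *: P n) q); apply: KS => //.
by apply: IH; [exact: ltnW|exact: size_graded_reduce].
Qed.

End GradedBasis.

(** * Orthogonal polynomials for a definite functional on the half line *)

(** [J] plays the role of integration against [w_t / x], so the inner product
    for which the [P n] are orthogonal is [J ('X * (p * q))]. *)
Section Algebra.
Variables (R : realFieldType) (J : {scalar {poly R}}).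
Hypothesis J_definite : forall p : {poly R},
  (forall x, 0 < x -> 0 <= p.[x]) -> J p = 0 -> p = 0.
Variable P : nat -> {poly R}.
Hypothesis sizeP : forall n, size (P n) = n.+1.
Hypothesis orthoP : forall n m, n != m -> J ('X * (P n * P m)) = 0.

Lemma ortho_lower m (q : {poly R}) : (size q <= m)%N -> J ('X * (P m * q)) = 0.
Proof.
apply: (graded_ind sizeP (K := fun q => J ('X * (P m * q)) = 0)) => [|n c {}q nm IH].
  by rewrite !mulr0 linear0.
rewrite !mulrDr linearD/= IH addr0 -!scalerAr scalarZ orthoP ?mulr0//.
by rewrite gtn_eqF.
Qed.

Lemma sqr_definite (p : {poly R}) : J (p * p) = 0 -> p = 0.
Proof.
move=> /J_definite h; apply/eqP; rewrite -[_ == _]orbb -mulf_eq0; apply/eqP.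
by apply: h => x _; rewrite hornerM -expr2 sqr_ge0.
Qed.

Lemma Xsqr_definite (p : {poly R}) : J ('X * (p * p)) = 0 -> p = 0.
Proof.
move=> /J_definite h; have /eqP : 'X * (p * p) = 0.
  by apply: h => x x0; rewrite !hornerM hornerX -expr2 mulr_ge0 ?sqr_ge0 ?ltW.
by rewrite !mulf_eq0 polyX_eq0 orbb => /eqP.
Qed.

(** If [P m = 'X * g] then [J (P m * P m) = J ('X * (P m * g))], which vanishes
    by orthogonality since [g] has lower degree: the weight [w_t / x] turns
    divisibility by ['X] into a loss of one degree. *)
Lemma ortho_coef0_neq0 m : (P m)`_0 != 0.
Proof.
apply/eqP => P0; have [g Pg sg] := poly_splitX (P m).
rewrite P0 add0r in Pg; rewrite sizeP/= in sg.
have XX : J (P m * P m) = 0.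
  by rewrite {2}Pg mulrCA ortho_lower// sg.
by have := sizeP m; rewrite (sqr_definite XX) size_poly0.
Qed.

(** [E] stands for [a] times the [t]-derivative of [P m.+1], corrected by a
    multiple of [P m.+1] so as to lose one degree; [E_dual] is what the
    differentiated orthogonality relations say about it. *)
Section Deformation.
Variables (m : nat) (E : {poly R}) (a : R).
Hypothesis sizeE : (size E <= m.+1)%N.
Hypothesis a_neq0 : a != 0.
Hypothesis E_dual : forall q : {poly R}, (size q <= m.+1)%N ->
  J ('X * (E * q)) = a * J (P m.+1 * q).

(** If [E] loses a further degree then ['X * E] is small enough for [E_dual],
    whose right-hand side vanishes on it, whence [E = 0].  Then [E_dual] says
    that [P m.+1] is also orthogonal to the lower degrees for the weight
    [w_t / x], which is impossible. *)
Lemma deformation_lead_neq0 : E`_m != 0.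
Proof.
apply/eqP => Em0.
have sE : (size E <= m)%N.
  apply/leq_sizeP => j; rewrite leq_eqVlt => /orP[/eqP<-//|mj].
  by rewrite nth_default// (leq_trans sizeE).
have E0 : E = 0.
  have sXE : (size ('X * E)%R <= m.+1)%N.
    by rewrite (leq_trans (size_polyMleq _ _))// size_polyX.
  have XE0 : J (('X * E) * ('X * E)) = 0.
    by rewrite -mulrA E_dual// mulrCA ortho_lower ?mulr0// (leq_trans sE).
  by move/sqr_definite/eqP : XE0; rewrite mulf_eq0 polyX_eq0 => /eqP.
(* The constant part of [P m.+1] is killed by [E_dual] with [E = 0], and its
   part divisible by ['X] by orthogonality. *)
have [g Pg sg] := poly_splitX (P m.+1); rewrite sizeP/= in sg.
have PP : J (P m.+1 * P m.+1) = 0.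
  rewrite {2}Pg mulrDr linearD/= [in X in _ + X]mulrCA ortho_lower ?sg// addr0.
  apply: (mulfI a_neq0); rewrite -E_dual ?E0; first by rewrite mul0r !mulr0 linear0.
  by rewrite (leq_trans (size_polyC_leq1 _)).
by have := sizeP m.+1; rewrite (sqr_definite PP) size_poly0.
Qed.

(** ['X * E] is orthogonal to every [q] of size at most [m], since
    [E_dual] applied to ['X * q] gives an orthogonality relation of [P m.+1].
    Hence subtracting the components along [P m.+1] and [P m] leaves a
    polynomial of size at most [m] that is orthogonal to itself. *)
Lemma deformation_two_term : exists c,
  'X * E = (E`_m / (P m.+1)`_m.+1) *: P m.+1 + c *: P m.
Proof.
have sXE : (size ('X * E)%R <= m.+2)%N.
  by rewrite (leq_trans (size_polyMleq _ _))// size_polyX.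
pose F := 'X * E - (E`_m / (P m.+1)`_m.+1) *: P m.+1.
have sF : (size F <= m.+1)%N.
  by have := size_graded_reduce sizeP sXE; rewrite coefXM.
pose c := F`_m / (P m)`_m; pose G := F - c *: P m.
have sG : (size G <= m)%N := size_graded_reduce sizeP sF.
exists c; suff G0 : G = 0 by rewrite addrC -[RHS]add0r -G0 /G /F subrKA addrNK.
have orthoG (q : {poly R}) : (size q <= m)%N -> J ('X * (G * q)) = 0.
  move=> sq; rewrite /G /F !mulrBl !mulrBr !linearB/= -!scalerAl -!scalerAr.
  rewrite !scalarZ !ortho_lower// 1?ltnW// !mulr0 !subr0.
  have -> : 'X * ('X * E * q) = 'X * (E * ('X * q)) by ring.
  have sXq : (size ('X * q)%R <= m.+1)%N.
    by rewrite (leq_trans (size_polyMleq _ _))// size_polyX.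
  by rewrite E_dual// mulrCA ortho_lower ?mulr0// ltnW.
by apply: Xsqr_definite; exact: orthoG.
Qed.

(** The second coefficient in [deformation_two_term] is determined by
    the vanishing of ['X * E] at [0]. *)
Lemma deformation_coefE k :
  (P m.+1)`_m.+1 * E`_k / (E`_m * (P m.+1)`_0) =
  (P m.+1)`_k.+1 / (P m.+1)`_0 - (P m)`_k.+1 / (P m)`_0.
Proof.
have [c XE] := deformation_two_term.
have coefXE i : ('X * E)`_i = E`_m / (P m.+1)`_m.+1 * (P m.+1)`_i + c * (P m)`_i.
  by rewrite XE coefD !coefZ.
have := coefXE 0; have := coefXE k.+1; rewrite !coefXM/= => -> E0.
have ec : c = - (E`_m / (P m.+1)`_m.+1 * (P m.+1)`_0) / (P m)`_0.
  apply: (canRL (mulfK (ortho_coef0_neq0 m))).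
  by apply/eqP; rewrite -addr_eq0 addrC -E0.
rewrite {}ec; have := deformation_lead_neq0; have := ortho_coef0_neq0 m.
have := ortho_coef0_neq0 m.+1; have := graded_lead_neq0 sizeP m.+1.
by move=> *; field; apply/and4P.
Qed.

End Deformation.
End Algebra.

(** * The moment functional of the weight divided by x *)

Lemma finite_roots (F : idomainType) (p : {poly F}) :
  p != 0 -> finite_set [set x | root p x].
Proof.
move=> p0; apply: contrapT => /(infinite_set_fset (size p))[B Bp].
rewrite leqNgt => /negP; apply; apply: (max_poly_roots p0); last exact: finmap.fset_uniq.
by apply/allP => x xB; exact: Bp.
Qed.

Section Functional.
Variables (R : realType) (nu : R).
Implicit Types (s t x : R) (p q : {poly R}).
Local Notation mu := (@lebesgue_measure R).
Local Notation pos := (`]0%R, +oo[%classic : set R).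
Local Notation w := (weight nu).

Lemma measurable_pos : measurable (pos : set (measurableTypeR R)).
Proof. exact: measurable_itv. Qed.

Lemma weight_ge0 t x : 0 <= w t x.
Proof. by rewrite mulr_ge0 ?expR_ge0 ?powR_ge0. Qed.

Lemma weight_gt0 t x : 0 < x -> 0 < w t x.
Proof. by move=> x0; rewrite mulr_gt0 ?expR_gt0 ?powR_gt0. Qed.

Lemma continuous_weight t x : 0 < x -> {for x, continuous (w t)}.
Proof.
move=> x0; apply: continuousM.
  apply: continuous_comp; last exact: continuous_expR.
  apply: continuousB; first by apply: continuousN; exact: cvg_id.
  by apply: continuousM; [exact: cvg_cst|apply: continuousV; rewrite ?gt_eqF//; exact: cvg_id].
apply: differentiable_continuous; apply/derivable1_diffP; apply: derivable_powR.
by rewrite in_itv/= x0.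
Qed.

Lemma measurable_poly_weight t (p : {poly R}) :
  measurable_fun pos (fun x => p.[x] * w t x).
Proof.
apply: open_continuous_measurable_fun; first exact: interval_open.
move=> x; rewrite inE/= in_itv/= andbT => x0.
by apply: continuousM; [exact: continuous_horner|exact: continuous_weight].
Qed.

Lemma measurable_poly_weightV t (p : {poly R}) :
  measurable_fun pos (fun x => p.[x] * (w t x / x)).
Proof.
apply: open_continuous_measurable_fun; first exact: interval_open.
move=> x; rewrite inE/= in_itv/= andbT => x0.
apply: continuousM; first exact: continuous_horner.
apply: continuousM; first exact: continuous_weight.
by apply: continuousV; rewrite ?gt_eqF//; exact: cvg_id.
Qed.

Lemma weight_le s t x : 0 < x -> s <= t -> w t x <= w s x.
Proof.
move=> x0 st; rewrite ler_wpM2r ?powR_ge0// ler_expR lerD2l lerN2.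
by rewrite ler_pM2r ?invr_gt0.
Qed.

(** Dividing by [x] costs only a decrease of the parameter [t]: with
    [u = (t - s) / x], this is [u <= expR u]. *)
Lemma weightV_le s t x : 0 < x -> s < t -> w t x / x <= w s x / (t - s).
Proof.
move=> x0 st; have ts : 0 < t - s by rewrite subr_gt0.
have e : (t - s) / x * expR (- x - t / x) <= expR (- x - s / x).
  have -> : - x - s / x = (t - s) / x + (- x - t / x) by ring.
  rewrite [leRHS]expRD ler_pM2r ?expR_gt0//.
  by apply: le_trans (expR_ge1Dx _); rewrite lerDr.
rewrite ler_pdivlMr//.
have -> : w t x / x * (t - s) = (t - s) / x * expR (- x - t / x) * x `^ nu.
  by rewrite /weight; ring.
by rewrite ler_wpM2r ?powR_ge0.
Qed.

(** An extended-real integral is the difference of the integrals of the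
    positive and negative parts, and such a difference is finite only if both
    terms are. *)
Lemma integrable_finite_integral (f : R -> R) : measurable_fun pos f ->
  (\int[mu]_(x in pos) (f x)%:E)%E \is a fin_num ->
  mu.-integrable pos (EFin \o f).
Proof.
move=> mf; rewrite integralE fin_numB => /andP[fp fn].
have mF : measurable_fun pos (EFin \o f) by exact/measurable_EFinP.
apply/integrableP; split=> //.
have -> : (\int[mu]_(x in pos) `|(EFin \o f) x| =
    \int[mu]_(x in pos) (EFin \o f)^\+ x + \int[mu]_(x in pos) (EFin \o f)^\- x)%E.
  rewrite -ge0_integralD//; [|exact: measurable_funepos|exact: measurable_funeneg].
  by apply: eq_integral => x _; rewrite -[LHS]/((abse \o (EFin \o f)) x) fune_abse.
by rewrite lte_add_pinfty// ltey_eq ?fp ?fn.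
Qed.

Hypothesis int_poly : forall t, 0 < t -> forall p : {poly R},
  mu.-integrable pos (EFin \o (fun x => p.[x] * w t x)).

Lemma integrable_poly_weightV t (p : {poly R}) : 0 < t ->
  mu.-integrable pos (EFin \o (fun x => p.[x] * (w t x / x))).
Proof.
move=> t0; have t2 : 0 < t / 2 by rewrite divr_gt0.
apply: (@le_integrable _ _ R mu pos _ _
   (EFin \o (fun x => ((t / 2)^-1 *: p).[x] * w (t / 2) x))).
- exact: measurable_pos.
- by apply/measurable_EFinP; exact: measurable_poly_weightV.
- move=> x; rewrite /= in_itv/= andbT => x0.
  rewrite lee_fin hornerZ [in leRHS](mulrC _ p.[x]) -[in leRHS](mulrA p.[x]).
  rewrite !(normrM p.[x]) ler_wpM2l//.
  rewrite !ger0_norm ?mulr_ge0 ?expR_ge0 ?powR_ge0 ?invr_ge0 ?(ltW x0) ?(ltW t2)//.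
  have tt : t - t / 2 = t / 2 by rewrite {1}(splitr t) addrK.
  rewrite [leRHS]mulrC -{2}tt; apply: weightV_le => //.
  by rewrite ltr_pdivrMr// ltr_pMr// ltr1n.
- exact: int_poly.
Qed.

Definition recip_moment t (p : {poly R}) : R :=
  \int[mu]_(x in pos) (p.[x] * (w t x / x)).

Lemma recip_moment_linear t : 0 < t -> scalar (recip_moment t).
Proof.
move=> t0 c p q; rewrite /recip_moment -RintegralZl//; last first.
  exact: integrable_poly_weightV.
rewrite -RintegralD//; last exact: integrable_poly_weightV.
  by apply: eq_Rintegral => x _; rewrite hornerD hornerZ mulrDl -[c * _ * _]mulrA.
have := integrable_poly_weightV (c *: p) t0.
by apply: eq_integrable => // x _ /=; rewrite hornerZ -[c * _ * _]mulrA.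
Qed.

(** A nonnegative integrand with zero integral vanishes almost everywhere; a
    nonzero polynomial has finitely many roots, and the half line is not
    negligible. *)
Lemma recip_moment_definite t (p : {poly R}) : 0 < t ->
  (forall x, 0 < x -> 0 <= p.[x]) -> recip_moment t p = 0 -> p = 0.
Proof.
move=> t0 p_ge0 Jp.
have mf := measurable_poly_weightV t p.
have intf := integrable_poly_weightV p t0.
have : (\int[mu]_(x in pos) `|(p.[x] * (w t x / x))%:E| = 0)%E.
  have -> : (\int[mu]_(x in pos) `|(p.[x] * (w t x / x))%:E| =
             \int[mu]_(x in pos) (p.[x] * (w t x / x))%:E)%E.
    apply: eq_integral => x; rewrite inE/= in_itv/= andbT => x0.
    by rewrite ger0_norm// mulr_ge0 ?p_ge0// divr_ge0 ?weight_ge0 ?ltW.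
  by rewrite -[LHS]fineK ?(integrable_fin_num _ intf)//; congr EFin.
move=> /(ae_eq_integral_abs mu measurable_pos) f0.
apply: contrapT => /eqP/finite_roots/finite_set_countable cr.
have nroot : mu.-negligible [set x | root p x].
  apply/negligibleP; last exact: countable_lebesgue_measure0.
  exact: countable_measurable.
have npos : mu.-negligible pos.
  apply: negligibleS (negligibleU (f0 _) nroot); last first.
    exact/measurable_EFinP.
  move=> x /= x_pos; have [root_px|nroot_px] := boolP (root p x); [by right|left].
  move/(_ x_pos) => /eqP; rewrite eqe mulf_eq0 -rootE (negbTE nroot_px) /=.
  move: x_pos; rewrite in_itv/= andbT => x0.
  by rewrite gt_eqF// divr_gt0// weight_gt0.
have : mu pos = 0%E := measure_negligible measurable_pos npos.
by rewrite lebesgue_measure_itv/= ltry.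
Qed.

Lemma is_derive_weight x t : 0 < x ->
  is_derive t 1 (fun s => w s x) (- (w t x / x)).
Proof.
move=> x0; rewrite /weight.
have h : is_derive t 1 (fun s : R => - x - s / x) (- x^-1).
  have -> : (fun s : R => - x - s / x) = cst (- x) - (x^-1 \*: id).
    by apply/funext => s; rewrite /= ?fctE mulrC.
  apply: is_derive_eq.
  by rewrite sub0r; congr (- _); rewrite /GRing.scale/= mulr1.
have he := @is_derive1_comp R expR (fun s : R => - x - s / x) t _ _ (is_derive_expR _) h.
have -> : (fun s => expR (- x - s / x) * x `^ nu) =
   x `^ nu \*: (expR \o (fun s => - x - s / x)).
  by apply/funext => s; rewrite /= ?fctE mulrC.
apply: is_derive_eq.
by rewrite /GRing.scale/=; ring.
Qed.

(** The parameter derivative of [('X * p) * (w_t / x)] is [- p * (w_t / x)].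
    As [w_t] decreases in [t], it is dominated near [t] by its value at the
    parameter [t / 2]. *)
Lemma is_derive_recip_moment t (p : {poly R}) : 0 < t ->
  is_derive t 1 (fun s => recip_moment s ('X * p)) (- recip_moment t p).
Proof.
move=> t0; pose f s x := ('X * p).[x] * (w s x / x).
have df s x : 0 < x -> is_derive s 1 (f ^~ x) (- (p.[x] * (w s x / x))).
  move=> x0; have -> : f ^~ x = p.[x] \*: (fun s => w s x).
    apply/funext => u; rewrite /f hornerM hornerX /= ?fctE.
    by rewrite /GRing.scale/=; field; rewrite gt_eqF.
  have hw := is_derive_weight s x0; apply: is_derive_eq.
  by rewrite /GRing.scale/= mulrN.
have t2 : 0 < t / 2 by rewrite divr_gt0.
pose G x := `|p.[x] * (w (t / 2) x / x)|.
have It : `](t / 2), (t * 2)[%classic t.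
  rewrite /= in_itv/= ltr_pdivrMr// !ltr_pMr// ltr1n//.
have intf s : `](t / 2), (t * 2)[%classic s -> mu.-integrable pos (EFin \o f s).
  rewrite /= in_itv/= => /andP[ts _].
  by apply: integrable_poly_weightV; exact: lt_trans ts.
have derf s x : `](t / 2), (t * 2)[%classic s -> pos x -> derivable (f ^~ x) s 1.
  by move=> _; rewrite /= in_itv/= andbT => x0; have [] := df s x x0.
have intG : mu.-integrable pos (EFin \o G).
  exact/integrable_norm/integrable_poly_weightV.
have G_ub s x : `](t / 2), (t * 2)[%classic s -> pos x -> `|partial1of2 f s x| <= G x.
  rewrite /= !in_itv/= andbT => /andP[ts _] x0.
  have -> : partial1of2 f s x = - (p.[x] * (w s x / x)).
    by have hd := df s x x0; rewrite partial1of2E derive_val.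
  rewrite normrN /G !(normrM p.[x]) ler_wpM2l//.
  rewrite !ger0_norm ?divr_ge0 ?weight_ge0 ?(ltW x0)//.
  by rewrite ler_pM2r ?invr_gt0// weight_le// ltW.
have G0 x : 0 <= G x by exact: normr_ge0.
have dI := derivable_under_integral measurable_pos It intf derf G0 intG G_ub.
have := differentiation_under_integral measurable_pos It intf derf G0 intG G_ub.
rewrite derive1E => eI; apply: DeriveDef; first exact: dI.
rewrite [LHS]eI -[in RHS]mulN1r -RintegralZl//; last exact: integrable_poly_weightV.
apply: eq_Rintegral => x; rewrite inE/= in_itv/= andbT => x0.
by have hd := df t x x0; rewrite partial1of2E derive_val mulN1r.
Qed.

End Functional.

(** * Differentiating the orthogonality relations *)

Section Orthonormal.
Variables (R : realType) (nu : R) (P : nat -> R -> {poly R}).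
Hypothesis hP : orthonormal_polys nu P.
Hypothesis hC1 : forall n k, C1_pos (coef P n k).
Implicit Types (s t : R) (p q : {poly R}) (n m k : nat).
Local Notation mu := (@lebesgue_measure R).
Local Notation pos := (`]0%R, +oo[%classic : set R).
Local Notation J := (recip_moment nu).

Lemma size_ortho t n : 0 < t -> size (P n t) = n.+1.
Proof. by move=> /hP[+ _ _]; apply. Qed.

(** Orthonormality with [P 0], a nonzero constant, already makes each [P n]
    integrable against the weight. *)
Lemma integrable_poly_weight t : 0 < t -> forall p,
  mu.-integrable pos (EFin \o (fun x => p.[x] * weight nu t x)).
Proof.
move=> t0 p; have sizeP n := size_ortho n t0.
have intPP n m :
    mu.-integrable pos (EFin \o (fun x => (P n t * P m t).[x] * weight nu t x)).
  apply: integrable_finite_integral; first exact: measurable_poly_weight.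
  have [_ _ /(_ n m) orth] := hP t0.
  under eq_integral do rewrite hornerM.
  by rewrite orth.
pose c0 := (P 0 t)`_0.
have c0_neq0 : c0 != 0 := graded_lead_neq0 (P := P^~ t) sizeP 0.
have P0E : P 0 t = c0%:P by apply: size1_polyC; rewrite sizeP.
pose K q := mu.-integrable pos (EFin \o (fun x => q.[x] * weight nu t x)).
apply: (graded_ind (P := P^~ t) sizeP (K := K) (m := size p)) => //.
  rewrite /K (_ : _ \o _ = cst 0%E); last by apply/funext => x; rewrite /= horner0 mul0r.
  exact: integrable0.
move=> n c q _ Kq; rewrite /K.
have -> : (EFin \o (fun x => (c *: P n t + q).[x] * weight nu t x)) =
  ((fun x => (c / c0)%:E * ((P n t * P 0 t).[x] * weight nu t x)%:E) \+
   (EFin \o (fun x => q.[x] * weight nu t x)%R))%E.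
  apply/funext => x /=; rewrite -EFinM -EFinD P0E hornerD hornerZ hornerM hornerC.
  by congr EFin; field.
have mpos := @measurable_pos R.
exact: (integrableD mpos (integrableZl mpos (c / c0) (intPP n 0)) Kq).
Qed.

Lemma recip_momentX t p : J t ('X * p) =
  \int[mu]_(x in pos) (p.[x] * weight nu t x).
Proof.
apply: eq_Rintegral => x; rewrite inE/= in_itv/= andbT => x0.
by rewrite hornerM hornerX; field; rewrite gt_eqF.
Qed.

Lemma recip_moment_ortho t n m : 0 < t -> n != m ->
  J t ('X * (P n t * P m t)) = 0.
Proof.
move=> t0 nm; rewrite recip_momentX /Rintegral.
have [_ _ /(_ n m)] := hP t0; rewrite (negbTE nm) => orth.
by under eq_integral do rewrite hornerM; rewrite orth.
Qed.

Definition recip_functional t (t0 : 0 < t) : {scalar {poly R}} :=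
  HB.pack (J t) (GRing.isLinear.Build R {poly R} R *%R (J t)
    (recip_moment_linear integrable_poly_weight t0)).

Lemma recip_functional_definite t (t0 : 0 < t) p :
  (forall x, 0 < x -> 0 <= p.[x]) -> recip_functional t0 p = 0 -> p = 0.
Proof. exact (recip_moment_definite integrable_poly_weight t0). Qed.

Lemma recip_functional_ortho t (t0 : 0 < t) n m : n != m ->
  recip_functional t0 ('X * (P n t * P m t)) = 0.
Proof. exact: recip_moment_ortho. Qed.

Lemma recip_ortho_lower t n q : 0 < t -> (size q <= n)%N ->
  J t ('X * (P n t * q)) = 0.
Proof.
move=> t0; apply: (ortho_lower (P := P^~ t) _ (@recip_functional_ortho t t0)).
by move=> {}n; exact: size_ortho.
Qed.

Definition deriv_coefs t n : {poly R} :=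
  \poly_(i < n.+1) derive1 (coef P n i) t.

(** Leibniz rule for the constant function [s |-> J s ('X * (P n s * q)) = 0]:
    differentiating the coefficients of [P n s] gives the left-hand side, and
    differentiating the weight gives minus the right-hand side. *)
Lemma deriv_coefs_dual t n q : 0 < t -> (size q <= n)%N ->
  J t ('X * (deriv_coefs t n * q)) = J t (P n t * q).
Proof.
move=> t0 sq.
pose h (i : 'I_n.+1) s := coef P n i s * J s ('X * ('X^i * q)).
have hE s : 0 < s -> \sum_(i < n.+1) h i s = 0.
  move=> s0; rewrite -[RHS](recip_ortho_lower s0 sq).
  rewrite -[J s _]/(recip_functional s0 _).
  rewrite -[P n s]coefK poly_def size_ortho// mulr_suml mulr_sumr linear_sum.
  by apply: eq_bigr => i _; rewrite -scalerAl -scalerAr scalarZ.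
have dh i : is_derive t 1 (h i)
   (derive1 (coef P n i) t * J t ('X * ('X^i * q))
     - coef P n i t * J t ('X^i * q)).
  have dJ := is_derive_recip_moment integrable_poly_weight ('X^i * q) t0.
  have dc : is_derive t 1 (coef P n i) (derive1 (coef P n i) t).
    by apply: DeriveDef; [exact: (hC1 n i t0).1|rewrite derive1E].
  have -> : h i = coef P n i * (fun s => J s ('X * ('X^i * q))) by [].
  by apply: is_derive_eq; rewrite /GRing.scale/=; ring.
have := is_derive_sum dh => dsum.
have d0 : is_derive t 1 (\sum_(i < n.+1) h i) 0.
  apply: near_eq_is_derive (is_derive_cst 0 t 1).
  near=> s; rewrite /cst fct_sumE hE//.
  by near: s; exact: lt_nbhsr.
have : \sum_(i < n.+1) (derive1 (coef P n i) t * J t ('X * ('X^i * q))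
     - coef P n i t * J t ('X^i * q)) = 0.
  by rewrite -(@derive_val _ _ _ _ _ _ _ dsum) (@derive_val _ _ _ _ _ _ _ d0).
rewrite sumrB => /eqP; rewrite subr_eq0 => /eqP sumE.
transitivity (\sum_(i < n.+1) derive1 (coef P n i) t * J t ('X * ('X^i * q))).
  rewrite -[LHS]/(recip_functional t0 _).
  rewrite /deriv_coefs poly_def mulr_suml mulr_sumr linear_sum.
  by apply: eq_bigr => i _; rewrite -scalerAl -scalerAr scalarZ.
rewrite sumE -[RHS]/(recip_functional t0 _).
rewrite -[P n t in RHS]coefK poly_def size_ortho// mulr_suml linear_sum.
by apply: eq_bigr => i _; rewrite -scalerAl scalarZ.
Unshelve. all: by end_near. Qed.

(** Wronskian in [t] of the leading coefficient and each coefficient of [P n]. *)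
Definition wronskian t n : {poly R} :=
  lcoef P n t *: deriv_coefs t n - derive1 (lcoef P n) t *: P n t.

Lemma coef_wronskian t n k : (k <= n)%N ->
  (wronskian t n)`_k =
  lcoef P n t * derive1 (coef P n k) t - coef P n k t * derive1 (lcoef P n) t.
Proof.
move=> kn; rewrite coefB !coefZ coef_poly ltnS kn.
by rewrite [derive1 (lcoef P n) t * _]mulrC.
Qed.

Lemma size_wronskian t n : 0 < t -> (size (wronskian t n) <= n)%N.
Proof.
move=> t0; apply/leq_sizeP => j; rewrite leq_eqVlt => /orP[/eqP<-|nj].
  by rewrite coef_wronskian// /lcoef mulrC subrr.
rewrite coefB !coefZ coef_poly ltnS leqNgt nj.
by rewrite nth_default ?size_ortho// !mulr0 subrr.
Qed.

Lemma wronskian_dual t n q : 0 < t -> (size q <= n)%N ->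
  J t ('X * (wronskian t n * q)) = lcoef P n t * J t (P n t * q).
Proof.
move=> t0 sq; rewrite -deriv_coefs_dual//.
have ortho0 : recip_functional t0 ('X * (P n t * q)) = 0.
  exact: recip_ortho_lower.
rewrite -[LHS]/(recip_functional t0 _) mulrBl mulrBr -!scalerAl -!scalerAr.
by rewrite linearB !scalarZ ortho0 mulr0 subr0.
Qed.

Lemma lcoef_neq0 t n : 0 < t -> lcoef P n t != 0.
Proof.
by move=> t0; apply: (graded_lead_neq0 (P := P^~ t)) => m; exact: size_ortho.
Qed.

Lemma coef0_neq0 t n : 0 < t -> coef P n 0 t != 0.
Proof.
move=> t0; have sizeP m := size_ortho m t0.
exact (ortho_coef0_neq0 (@recip_functional_definite t t0) sizeP
  (@recip_functional_ortho t t0) n).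
Qed.

Lemma wronskian_lead_neq0 t n : 0 < t -> (wronskian t n.+1)`_n != 0.
Proof.
move=> t0; have sizeP m := size_ortho m t0.
exact (deformation_lead_neq0 (@recip_functional_definite t t0) sizeP
  (@recip_functional_ortho t t0) (size_wronskian _ t0) (lcoef_neq0 n.+1 t0)
  (fun q => wronskian_dual t0 (n := n.+1))).
Qed.

Lemma wronskian_coefE t n k : 0 < t ->
  lcoef P n.+1 t * (wronskian t n.+1)`_k
    / ((wronskian t n.+1)`_n * coef P n.+1 0 t) =
  coef P n.+1 k.+1 t / coef P n.+1 0 t - coef P n k.+1 t / coef P n 0 t.
Proof.
move=> t0; have sizeP m := size_ortho m t0.
exact (deformation_coefE (@recip_functional_definite t t0) sizeP
  (@recip_functional_ortho t t0) (size_wronskian _ t0) (lcoef_neq0 n.+1 t0)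
  (fun q => wronskian_dual t0 (n := n.+1)) k).
Qed.

End Orthonormal.

Theorem theorem6 (R : realType) (nu : R) (P : nat -> R -> {poly R})
    (hP : orthonormal_polys nu P)
    (hC1 : forall n k : nat, C1_pos (coef P n k))
    (t : R) (ht : 0 < t) (n : nat) (hn : (1 <= n)%N)
    (k : nat) (hk : (1 <= k <= n)%N) :
  (forall m : nat, (k <= m <= n)%N ->
     lcoef P m t * derive1 (sublcoef P m) t - sublcoef P m t * derive1 (lcoef P m) t != 0
     /\ coef P m 0 t != 0)
  /\
  coef P n k t =
    coef P n 0 t *
    \sum_(k <= m < n.+1)
      (lcoef P m t *
         (lcoef P m t * derive1 (coef P m k.-1) t - coef P m k.-1 t * derive1 (lcoef P m) t))
      / ((lcoef P m t * derive1 (sublcoef P m) t - sublcoef P m t * derive1 (lcoef P m) t)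
         * coef P m 0 t).
Proof.
have subE m : lcoef P m.+1 t * derive1 (sublcoef P m.+1) t
    - sublcoef P m.+1 t * derive1 (lcoef P m.+1) t = (wronskian P t m.+1)`_m.
  by rewrite coef_wronskian.
move: k hk => [//|k] /= kn; split.
  move=> [//|m] _; split; last exact: (coef0_neq0 hP).
  by rewrite subE; exact: (wronskian_lead_neq0 hP).
(* Indices are shifted by one so that the sum from [k.+1] to [n] starts with a
   predecessor, [P k], which has no coefficient of degree [k.+1]. *)
pose f j := coef P j.-1 k.+1 t / coef P j.-1 0 t.
rewrite (telescope_sumr_eq f); first last.
- move=> [//|m] /andP[km _].
  rewrite subE -coef_wronskian; last exact: ltnW.
  exact: (wronskian_coefE hP hC1).
- exact: leqW.
rewrite /f/= [coef P k k.+1 t]nth_default ?(size_ortho hP)// mul0r subr0.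
by rewrite mulrC divfK// (coef0_neq0 hP).
Qed.
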